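(* Let $X$ be a real Banach space such that $X\in(\mathrm{GC})$ and let $Y$ be an almost constrained subspace of $X$. Then $Y\in(\mathrm{GC})$.
   Context: All Banach spaces are real; ''subspace'' means closed linear subspace; $B_X(x,r)$ denotes the closed ball in $X$ with center $x$ and radius $r>0$; $X$ is canonically embedded in its bidual $X^{**}$. $(\mathrm{GC})$: $X\in(\mathrm{GC})$ if for every finite subset $\{x_1,\dots,x_N\}$ of $X$ and all $r_1,\dots,r_N>0$, $\bigcap_{i=1}^N B_{X^{**}}(x_i,r_i)\neq\emptyset$ implies $\bigcap_{i=1}^N B_X(x_i,r_i)\neq\emptyset$. Almost constrained: a subspace $Y$ of $X$ is almost constrained in $X$ if for every $x\in X\setminus Y$ there exists a norm-one linear projection $P:\operatorname{span}\{x,Y\}\to Y$ onto $Y$. *)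

(* Defs.v *)
From HB Require Import structures.
From mathcomp Require Import all_boot all_order all_algebra.
From mathcomp Require Import all_classical all_reals all_analysis.

Set Implicit Arguments.
Unset Strict Implicit.
Unset Printing Implicit Defensive.

Import Order.TTheory GRing.Theory Num.Theory.
Import numFieldNormedType.Exports.

Local Open Scope classical_set_scope.
Local Open Scope ring_scope.

Section OperatorNorm.
Context (R : realType) (V W : normedModType R).

(* Operator norm.  Pitfall: [sup] of an unbounded set is 0, so this is the
   operator norm only for bounded (equivalently, continuous) linear [f]. *)
Definition opnorm (f : V -> W) : R :=
  sup [set `|f x| | x in [set x : V | `|x| <= 1]].

Lemma opnorm_has_sup (f : {linear V -> W}) : continuous f ->
  has_sup [set `|f x| | x in [set x : V | `|x| <= 1]].
Proof.
move=> fc; split; first by exists `|f 0|, 0 => //=; rewrite normr0.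
have /linear_bounded_continuous/bounded_funP/(_ 1)[M fM] := fc.
by exists M => _ [x /= x1 <-]; exact: fM.
Qed.

Lemma opnorm_ge0 (f : V -> W) : 0 <= opnorm f.
Proof.
rewrite /opnorm; set A := (X in sup X).
have [sA|/sup_out ->//] := pselect (has_sup A).
apply: (@le_trans _ _ `|f 0|) => //; apply: (sup_upper_bound sA).
by exists 0 => //=; rewrite normr0.
Qed.

Lemma le_opnorm (f : {linear V -> W}) : continuous f ->
  forall x, `|f x| <= opnorm f * `|x|.
Proof.
move=> fc x; have [->|x0] := eqVneq x 0; first by rewrite linear0 !normr0 mulr0.
have nx : 0 < `|x| by rewrite normr_gt0.
rewrite -ler_pdivrMr// mulrC.
have -> : `|x|^-1 * `|f x| = `|f (`|x|^-1 *: x)|.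
  by rewrite linearZ normrZ ger0_norm// invr_ge0.
apply: (sup_upper_bound (opnorm_has_sup fc)); exists (`|x|^-1 *: x) => //=.
by rewrite normrZ ger0_norm ?invr_ge0// mulVf// gt_eqF.
Qed.

Lemma opnorm_le (f : V -> W) (M : R) :
  (forall x, `|x| <= 1 -> `|f x| <= M) -> opnorm f <= M.
Proof.
move=> fM; apply: ge_sup; first by exists `|f 0|, 0 => //=; rewrite normr0.
by move=> _ [x /= x1 <-]; exact: fM.
Qed.

End OperatorNorm.

Section DualSpace.
Context (R : realType) (V : normedModType R).

Definition dual_pred : {pred (V -> R^o)} :=
  mem [set f : V -> R^o | linear f /\ continuous f].

Lemma dual_submod_closed : submod_closed dual_pred.
Proof.
split=> [|a f g]; rewrite !inE /=.
  split; first by move=> a u v; rewrite scaler0 addr0.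
  by move=> x; exact: cvg_cst.
move=> [fl fc] [gl gc]; split.
  move=> b u v /=.
  have e (x : V) : (a *: f + g) x = a *: f x + g x by [].
  by rewrite !e fl gl !scalerDr !scalerA (mulrC a) addrACA.
move=> x; apply: cvgD; last exact: gc.
by apply: cvgZr; exact: fc.
Qed.

HB.instance Definition _ :=
  GRing.isSubmodClosed.Build R (V -> R^o) dual_pred
    dual_submod_closed.

Record normed_dual :=
  NormedDual { dual_fun :> V -> R^o; _ : dual_fun \in dual_pred }.

HB.instance Definition _ := [isSub for dual_fun].
HB.instance Definition _ := [Choice of normed_dual by <:].
HB.instance Definition _ := [SubChoice_isSubLmodule of normed_dual by <:].

Lemma dual_linear (f : normed_dual) : linear (f : V -> R^o).
Proof. by case: f => f /= /set_mem[]. Qed.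

Lemma dual_continuous (f : normed_dual) : continuous (f : V -> R^o).
Proof. by case: f => f /= /set_mem[]. Qed.

HB.instance Definition _ (f : normed_dual) :=
  GRing.isLinear.Build R V R^o _ (dual_fun f) (dual_linear f).

Lemma le_dual_norm (f : normed_dual) (x : V) : `|f x| <= opnorm f * `|x|.
Proof. exact: (@le_opnorm R V R^o f (@dual_continuous f)). Qed.

Lemma dual_ler_normD (f g : normed_dual) :
  opnorm (f + g : normed_dual) <= opnorm f + opnorm g.
Proof.
apply: opnorm_le => x x1.
rewrite (le_trans (ler_normD (f x) (g x)))// lerD//.
- by rewrite (le_trans (le_dual_norm f x))// ler_piMr// opnorm_ge0.
- by rewrite (le_trans (le_dual_norm g x))// ler_piMr// opnorm_ge0.
Qed.

Lemma dual_normrZ_le (a : R) (f : normed_dual) :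
  opnorm (a *: f : normed_dual) <= `|a| * opnorm f.
Proof.
apply: opnorm_le => x x1.
have -> : `|(a *: f : normed_dual) x| = `|a| * `|f x| by exact: normrM.
rewrite ler_wpM2l//.
by rewrite (le_trans (le_dual_norm f x))// ler_piMr// opnorm_ge0.
Qed.

Lemma dual_normr0_eq0 (f : normed_dual) : opnorm f = 0 -> f = 0.
Proof.
move=> f0; apply/val_inj/funext => x /=.
by apply/eqP; rewrite -normr_le0 (le_trans (le_dual_norm f x))// f0 mul0r.
Qed.

Lemma dual_normrZ (a : R) (f : normed_dual) :
  opnorm (a *: f : normed_dual) = `|a| * opnorm f.
Proof.
apply/le_anti/andP; split; first exact: dual_normrZ_le.
have [->|a0] := eqVneq a 0; first by rewrite normr0 mul0r opnorm_ge0.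
rewrite -ler_pdivlMl ?normr_gt0// -normfV.
have {1}-> : f = a^-1 *: (a *: f) by rewrite scalerA mulVf// scale1r.
exact: dual_normrZ_le.
Qed.

HB.instance Definition _ :=
  Lmodule_isNormed.Build R normed_dual
    dual_ler_normD dual_normrZ dual_normr0_eq0.

End DualSpace.

Notation bidual V := (normed_dual (normed_dual V)).

Section Bidual.
Context (R : realType) (V : normedModType R).

Lemma bidual_embed_subproof (x : V) :
  (fun f : normed_dual V => f x : R^o) \in @dual_pred R (normed_dual V).
Proof.
have l : linear (fun f : normed_dual V => f x : R^o) by [].
pose ev : {linear normed_dual V -> R^o} :=
  HB.pack (fun f : normed_dual V => f x : R^o)
    (GRing.isLinear.Build _ _ _ _ _ l).
apply/mem_set; split=> //=.
apply/(@linear_bounded_continuous _ _ _ ev)/bounded_funP => r.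
exists (r * `|x|) => f fr.
by rewrite (le_trans (le_dual_norm f x))// ler_wpM2r.
Qed.

Definition bidual_embed (x : V) : bidual V :=
  NormedDual (bidual_embed_subproof x).

End Bidual.

Section LinearSubspace.
Context (R : realType) (V : normedModType R).

Definition is_subspace (S : set V) := submod_closed (mem S).

Record lin_subspace := LinSubspace {
  subspace_set :> set V;
  subspaceP : is_subspace subspace_set }.

Definition subspace_pred (S : lin_subspace) : {pred V} := mem (subspace_set S).

HB.instance Definition _ (S : lin_subspace) :=
  GRing.isSubmodClosed.Build R V (subspace_pred S)
    (GRing.submod_closed_semi (subspaceP S)).

Record subspace_type (S : lin_subspace) :=
  SubspaceElt { subspace_val :> V; _ : subspace_val \in subspace_pred S }.

Section Instances.
Variable S : lin_subspace.
Local Notation T := (subspace_type S).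

HB.instance Definition _ := [isSub for @subspace_val S].
HB.instance Definition _ := [Choice of T by <:].
HB.instance Definition _ := [SubChoice_isSubLmodule of T by <:].

Let norm (x : T) : R := `|val x|.

Lemma subspace_ler_normD (x y : T) : norm (x + y) <= norm x + norm y.
Proof. exact: ler_normD. Qed.

Lemma subspace_normrZ (a : R) (x : T) : norm (a *: x) = `|a| * norm x.
Proof. exact: normrZ. Qed.

Lemma subspace_normr0_eq0 (x : T) : norm x = 0 -> x = 0.
Proof. by move=> /normr0_eq0 x0; exact/val_inj. Qed.

HB.instance Definition _ := Lmodule_isNormed.Build R T
  subspace_ler_normD subspace_normrZ subspace_normr0_eq0.

End Instances.

Definition lin_span (A : set V) : set V := smallest is_subspace A.

Lemma lin_span_is_subspace (A : set V) : is_subspace (lin_span A).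
Proof.
split; first by apply/mem_set => S [[/set_mem S0 _] _].
move=> a u v /set_mem uS /set_mem vS; apply/mem_set => S [Sl AS].
by apply/set_mem/Sl.2; apply/mem_set; [exact: uS|exact: vS].
Qed.

Definition lin_span_subspace (A : set V) : lin_subspace :=
  LinSubspace (lin_span_is_subspace A).

End LinearSubspace.

Section ClosedSubspace.
Context (R : realType) (X : completeNormedModType R).

Record closed_subspace := ClosedSubspace {
  closed_subspace_subspace :> lin_subspace X;
  closed_subspaceP : closed (closed_subspace_subspace : set X) }.

Definition banach_subspace (Y : closed_subspace) : Type := subspace_type Y.

Section Complete.
Variable Y : closed_subspace.

HB.instance Definition _ := NormedModule.on (banach_subspace Y).

Lemma banach_subspace_complete (F : set_system (banach_subspace Y)) :
  ProperFilter F -> cauchy F -> cvg F.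
Proof.
move=> FF Fc.
pose v (y : banach_subspace Y) : X := val (y : subspace_type Y).
have vc : cauchy (v @ F).
  apply/cauchyP => e e0.
  have /cauchyP/(_ e e0)[y Fy] := Fc; exists (v y).
  by rewrite -ball_normE in Fy; rewrite -ball_normE.
have /cvg_ex[l vl] : cvg (v @ F) by exact: cauchy_cvg.
have Yl : (Y : set X) l.
  have Yv : \forall y \near F, (Y : set X) (v y).
    by apply: nearW => y; apply/set_mem; exact: (valP (y : subspace_type Y)).
  exact: (closed_cvg _ (@closed_subspaceP Y) Yv l vl).
apply/cvg_ex; exists (SubspaceElt (mem_set Yl) : banach_subspace Y).
apply/cvgrPdist_le => e e0.
by move/cvgrPdist_le : vl => /(_ e e0).
Qed.

HB.instance Definition _ :=
  Uniform_isComplete.Build (banach_subspace Y) banach_subspace_complete.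

End Complete.

End ClosedSubspace.

Definition GC (R : realType) (X : completeNormedModType R) : Prop :=
  forall (N : nat) (x : 'I_N -> X) (r : 'I_N -> R),
    (forall i, 0 < r i) ->
    \bigcap_i closed_ball (bidual_embed (x i)) (r i) !=set0 ->
    \bigcap_i closed_ball (x i) (r i) !=set0.

(* A norm-one projection of the span onto [Y], with [Y] seen inside the span:
   an idempotent bounded linear operator of norm 1 with range [Y]. *)
Definition almost_constrained (R : realType) (X : completeNormedModType R)
    (Y : closed_subspace X) : Prop :=
  forall x : X, ~ (Y : set X) x ->
  let Z : normedModType R := subspace_type (lin_span_subspace (x |` Y)) in
  exists P : {linear Z -> Z},
    [/\ P \o P =1 P, range P = [set z | (Y : set X) (val z)],
        continuous P & opnorm P = 1].

(* Main.v *)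
Require Import Defs.
From HB Require Import structures.
From mathcomp Require Import all_boot all_order all_algebra.
From mathcomp Require Import all_classical all_reals all_analysis.

(** The second adjoint of the inclusion of [Y] in [X] is a contraction from
    [Y**] to [X**] extending that inclusion.  A common point of balls of [Y**]
    centred in [Y] is thus sent to a common point of the corresponding balls of
    [X**], and (GC) for [X] yields a common point [x] in [X].  If [x] is not in
    [Y], a norm-one projection of [span {x, Y}] onto [Y] fixes the centres, so
    it moves [x] into [Y] without leaving the balls. *)

Set Implicit Arguments.
Unset Strict Implicit.
Unset Printing Implicit Defensive.

Import Order.TTheory GRing.Theory Num.Theory.
Import numFieldNormedType.Exports.

Local Open Scope classical_set_scope.
Local Open Scope ring_scope.

Section Adjoint.
Context (R : realType) (V W : normedModType R) (j : {linear V -> W}).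
Hypothesis j_le : forall v, `|j v| <= `|v|.

Lemma contraction_continuous : continuous j.
Proof.
apply/linear_bounded_continuous/bounded_funP => r.
by exists r => v; exact: le_trans.
Qed.

Lemma adjoint_subproof (f : normed_dual W) :
  (fun v : V => f (j v) : R^o) \in @dual_pred R V.
Proof.
apply/mem_set; split=> [a u v|v]; first by rewrite !linearP.
apply: continuous_comp; first exact: contraction_continuous.
exact: dual_continuous.
Qed.

Definition adjoint (f : normed_dual W) : normed_dual V :=
  NormedDual (adjoint_subproof f).

Lemma adjoint_linear : linear adjoint.
Proof. by move=> a f g; exact/val_inj. Qed.

HB.instance Definition _ :=
  GRing.isLinear.Build R (normed_dual W) (normed_dual V) _ adjoint
    adjoint_linear.

(** [j] maps the unit ball of [V] into that of [W]. The bound has the shape of [j_le], so the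
    construction can be iterated on [adjoint] itself. *)
Lemma adjoint_norm_le (f : normed_dual W) : `|adjoint f| <= `|f|.
Proof.
apply: opnorm_le => v v1 /=.
rewrite (le_trans (le_dual_norm f (j v)))// ler_piMr ?opnorm_ge0//.
exact: le_trans (j_le v) v1.
Qed.

End Adjoint.

Section SecondAdjoint.
Context (R : realType) (V W : normedModType R) (j : {linear V -> W}).
Hypothesis j_le : forall v, `|j v| <= `|v|.

Let second_adjoint : bidual V -> bidual W := adjoint (adjoint_norm_le j_le).

(** Both sides evaluate a functional [f] on [W] at [j v]. *)
Lemma second_adjoint_embed (v : V) :
  second_adjoint (bidual_embed v) = bidual_embed (j v).
Proof. exact/val_inj. Qed.

Lemma bidual_balls_contraction (T : Type) (c : T -> V) (r : T -> R) :
  (forall i, 0 < r i) ->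
  \bigcap_i closed_ball (bidual_embed (c i)) (r i) !=set0 ->
  \bigcap_i closed_ball (bidual_embed (j (c i))) (r i) !=set0.
Proof.
move=> r0 [F Fc]; exists (second_adjoint F) => i _.
(* Positivity of the radii turns [closed_ball], the closure of an open ball, into a norm
   inequality. *)
have := Fc i I; rewrite !closed_ballE// /closed_ball_ /=.
rewrite -second_adjoint_embed -linearB; apply: le_trans.
exact: adjoint_norm_le.
Qed.

End SecondAdjoint.

(** The point [y] is chosen before [c], so it serves all the balls at once. *)
Lemma almost_constrained_retract (R : realType) (X : completeNormedModType R)
    (Y : closed_subspace X) : almost_constrained Y ->
  forall x : X, exists y : X, (Y : set X) y /\
    forall c : X, (Y : set X) c -> `|c - y| <= `|c - x|.
Proof.
move=> acY x; have [Yx|nYx] := pselect ((Y : set X) x); first by exists x.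
have [P [PP rP cP nP]] := acY x nYx.
set S := lin_span_subspace (x |` Y) in P PP rP cP nP *.
have spanS : x |` (Y : set X) `<=` S by exact: sub_smallest.
pose elt u (Su : (S : set X) u) : subspace_type S :=
  @SubspaceElt _ _ S u (mem_set Su).
pose z := elt x (spanS x (or_introl erefl)).
have YP u : (Y : set X) (val (P u)).
  have : range P (P u) by exists u.
  by rewrite rP.
exists (val (P z)); split=> // c Yc.
pose d := elt c (spanS c (or_intror Yc)).
(* [d] lies in the range of [P], and an idempotent fixes its range. *)
have Pd : P d = d.
  have : range P d by rewrite rP.
  by move=> [u _ <-]; exact: PP.
(* Since [opnorm P = 1], this bounds the norm of [P (d - z) = d - P z] by that of [d - z]. *)
have := le_opnorm cP (d - z).
by rewrite nP mul1r linearB Pd.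
Qed.

Theorem corollary2p4 (R : realType) (X : completeNormedModType R)
    (Y : closed_subspace X) :
  GC X -> almost_constrained Y -> GC (banach_subspace Y).
Proof.
move=> gcX acY N c r r0 cr.
pose j (y : banach_subspace Y) : X := val (y : subspace_type Y).
have jl : linear j by [].
pose J : {linear banach_subspace Y -> X} :=
  HB.pack j (GRing.isLinear.Build _ _ _ _ j jl).
(* The norm of [Y] is the restriction of that of [X], so [J] is isometric. *)
have J_le (y : banach_subspace Y) : `|J y| <= `|y| by [].
have [x xr] := gcX _ _ _ r0 (bidual_balls_contraction J_le r0 cr).
have [y [Yy yx]] := almost_constrained_retract acY x.
exists (@SubspaceElt _ _ Y y (mem_set Yy) : banach_subspace Y) => i _.
have := xr i I; rewrite !closed_ballE// /closed_ball_ /=; apply: le_trans.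
by apply: yx; apply/set_mem; exact: (valP (c i : subspace_type Y)).
Qed.
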